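(* Let $0<p<1$, let $\{X_n,\ n\ge1\}$ be the steps of the elephant random walk that remembers only the first and the most recent step, with $P(X_1=1)=p=1-P(X_1=-1)$, and let $S_n=\sum_{k=1}^n X_k$. Then, as $n\to\infty$, $\dfrac{S_n}{n}$ converges in distribution to a random variable $S$ that equals $\dfrac{2p-1}{3-2p}$ with probability $p$ and $-\dfrac{2p-1}{3-2p}$ with probability $1-p$. Moreover, $E(S_n/n)^r\to E(S^r)$ for all $r>0$, since $|S_n/n|\le 1$ for all $n$.
   Context: Elephant random walk remembering only the first and the most recent step: $X_2=X_1$ with probability $p$ and $X_2=-X_1$ with probability $1-p$; for every $n\ge2$, choose $K$ uniformly on $\{1,n\}$ and set $X_{n+1}=X_K$ with probability $p$ and $X_{n+1}=-X_K$ with probability $1-p$. All index choices and sign choices are mutually independent and independent of $X_1$. The notation $E(S_n/n)^r$ means the expectation of the $r$-th power of $S_n/n$. *)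

(* Defs.v *)
From HB Require Import structures.
From mathcomp Require Import all_boot all_order all_algebra.
From mathcomp Require Import all_classical all_reals all_analysis measurable_realfun.

Set Implicit Arguments.
Unset Strict Implicit.
Unset Printing Implicit Defensive.

Import Order.TTheory GRing.Theory Num.Theory.
Import numFieldNormedType.Exports.

Local Open Scope classical_set_scope.
Local Open Scope ring_scope.

(* Mutual independence of the families of events [F i], [i] in [D]: the product
   rule over every finite subset of [D].  Indices outside [D] are ignored. *)
Definition mutually_independent d (T : measurableType d) (R : realType)
    (P : probability T R) (I : eqType) (D : set I) (F : I -> set_system T) : Prop :=
  forall (s : seq I) (A : I -> set T),
    uniq s -> (forall i, i \in s -> D i) -> (forall i, i \in s -> F i (A i)) ->
    P (\big[setI/setT]_(i <- s) A i) = (\prod_(i <- s) P (A i))%E.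

Section elephant_random_walk.
Context d (Omega : measurableType d) (R : realType) (P : probability Omega R).

(* The random inputs of the walk: [None] is X_1, [Some (inl n)] is the index K_n
   (n >= 2) used for step n + 1, and [Some (inr n)] is the sign (n >= 2) of
   step n. *)
Definition erw_input : set (option (nat + nat)) :=
  [set i | match i with
           | None => True
           | Some (inl n) => (2 <= n)%N
           | Some (inr n) => (2 <= n)%N
           end].

Definition erw_input_events (X : nat -> {RV P >-> R}) (K : nat -> {RV P >-> nat})
    (e : nat -> {RV P >-> R}) (i : option (nat + nat)) : set_system Omega :=
  match i with
  | None => g_sigma_algebra_preimage (X 1%N)
  | Some (inl n) => g_sigma_algebra_preimage (K n)
  | Some (inr n) => g_sigma_algebra_preimage (e n)
  end.

(* [X n] is the step X_n for n >= 1; [X 0], [K 0], [K 1], [e 0] and [e 1] play no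
   role.  [e n = 1] (probability p) means that step n repeats the recalled step,
   [e n = -1] (probability 1 - p) that it reverses it. *)
Record erw_first_and_last (p : R) (X : nat -> {RV P >-> R})
    (K : nat -> {RV P >-> nat}) (e : nat -> {RV P >-> R}) : Prop := {
  erw_first_pos : P [set w | X 1%N w = 1] = p%:E;
  erw_first_neg : P [set w | X 1%N w = -1] = (1 - p)%:E;
  erw_sign_pos : forall n, (2 <= n)%N -> P [set w | e n w = 1] = p%:E;
  erw_sign_neg : forall n, (2 <= n)%N -> P [set w | e n w = -1] = (1 - p)%:E;
  erw_index_first : forall n, (2 <= n)%N -> P [set w | K n w = 1%N] = (2^-1)%:E;
  erw_index_last : forall n, (2 <= n)%N -> P [set w | K n w = n] = (2^-1)%:E;
  erw_independent : mutually_independent P erw_input (erw_input_events X K e);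
  erw_second : forall w, X 2%N w = e 2%N w * X 1%N w;
  erw_step : forall n, (2 <= n)%N ->
    forall w, X n.+1 w = e n.+1 w * X (K n w) w
}.

Definition walk (X : nat -> {RV P >-> R}) (n : nat) (w : Omega) : R :=
  \sum_(1 <= k < n.+1) X k w.

(* S_n / n; its value at n = 0 is 0. *)
Definition walk_mean (X : nat -> {RV P >-> R}) (n : nat) (w : Omega) : R :=
  walk X n w / n%:R.

Lemma measurable_walk_mean X n : measurable_fun [set: Omega] (walk_mean X n).
Proof.
apply: measurable_funM => //; apply: measurable_sum => k.
exact: measurable_funPT.
Qed.

HB.instance Definition _ X n :=
  isMeasurableFun.Build _ _ _ _ (walk_mean X n) (@measurable_walk_mean X n).

End elephant_random_walk.

Definition cvg_in_distribution d (T : measurableType d) d' (T' : measurableType d')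
    (R : realType) (P : probability T R) (P' : probability T' R)
    (Y : nat -> {RV P >-> R}) (Z : {RV P' >-> R}) : Prop :=
  forall x : R, {for x, continuous (cdf Z)} -> cdf (Y n) x @[n --> \oo] --> cdf Z x.

(* [Z] equals [c] with probability [p] and [- c] with probability [1 - p].  The law
   is given as a mixture of Dirac masses so that [c = 0], where the two values
   coincide, is covered. *)
Definition equals_pm d (T : measurableType d) (R : realType) (P : probability T R)
    (p c : R) (Z : {RV P >-> R}) : Prop :=
  forall A : set R, measurable A ->
    distribution P Z A = (p%:E * \d_c A + (1 - p)%:E * \d_(- c)%R A)%E.

Lemma equals_pm_exists (R : realType) (p c : R) : 0 <= p <= 1 ->
  exists Z : {RV (bernoulli_prob p : probability bool R) >-> R}, equals_pm p c Z.
Proof.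
move=> p01; pose f (b : bool) : R := if b then c else - c.
have mf : measurable_fun [set: bool] f by [].
pose Z : {mfun bool >-> R} := HB.pack f (isMeasurableFun.Build _ _ _ _ f mf).
by exists Z => A mA; rewrite /distribution /pushforward/= bernoulli_probE.
Qed.

(* Real and imaginary parts of the principal value of x ^ r, for real x and real
   r > 0: x ^ r = |x| ^ r * exp (i * pi * r) when x < 0.  (The library's [x `^ r] is
   meaningful only for x >= 0.) *)
Definition Re_power (R : realType) (r x : R) : R :=
  if 0 <= x then x `^ r else `|x| `^ r * cos (r * pi).

Definition Im_power (R : realType) (r x : R) : R :=
  if 0 <= x then 0 else `|x| `^ r * sin (r * pi).

Lemma Re_power_nat (R : realType) (n : nat) (x : R) : Re_power n%:R x = x ^+ n.
Proof.
rewrite /Re_power; case: ifPn => [/powR_mulrn -> //|]; rewrite -ltNge => x0.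
have -> : cos (n%:R * pi) = (-1) ^+ n :> R.
  elim: n => [|n IH]; first by rewrite mul0r cos0.
  by rewrite -natr1 mulrDl mul1r cosDpi IH exprS mulN1r.
by rewrite powR_mulrn// ltr0_norm// -exprMn mulrN1 opprK.
Qed.

Lemma Im_power_nat (R : realType) (n : nat) (x : R) : Im_power n%:R x = 0.
Proof.
rewrite /Im_power; case: ifPn => // _.
suff -> : sin (n%:R * pi) = 0 :> R by rewrite mulr0.
elim: n => [|n IH]; first by rewrite mul0r sin0.
by rewrite -natr1 mulrDl mul1r sinDpi IH oppr0.
Qed.

(* Main.v *)
(** The sign of X_1 factors out: X_n = X_1 Y_n, where Y_n is a function of the later
    inputs only, Y_1 = 1 and Y_(n+1) = e_(n+1) or e_(n+1) Y_n with probability 1/2 each.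
    Hence E(H (Y_(n+1) - c)) = (p - 1/2) E(H (Y_n - c)) for every bounded H depending
    on the inputs up to time n, where c = (2p - 1)/(3 - 2p) is the fixed point of
    y |-> (p - 1/2)(1 + y).  Taking for H the sum W_n of the Y_k - c, k <= n, the covariance
    E(W_n (Y_n - c)) stays bounded, so that E(W_n^2) = O(n) and S_n/n - c X_1 tends to 0
    in L^2.  It follows that E f(S_n/n) tends to E f(c X_1) = E f(S) for every f bounded on
    [-1, 1] and continuous at c and -c, which covers the indicators of rays and all the
    powers. *)
Require Import Defs.
From HB Require Import structures.
From mathcomp Require Import all_boot all_order all_algebra.
From mathcomp Require Import all_classical all_reals all_analysis.
From mathcomp Require Import measurable_realfun ring lra.

Set Implicit Arguments.
Unset Strict Implicit.
Unset Printing Implicit Defensive.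

Import Order.TTheory GRing.Theory Num.Theory.
Import numFieldNormedType.Exports.

Local Open Scope classical_set_scope.
Local Open Scope ereal_scope.
Local Open Scope ring_scope.

(** * Means of bounded measurable functions *)

Section bounded_measurable.
Context d (T : measurableType d) (R : realType) (P : probability T R).
Implicit Types (f g : T -> R) (A : set T).

Definition bounded_measurable f :=
  measurable_fun [set: T] f /\ exists M, forall w, `|f w| <= M.

Lemma bounded_measurable_cst (k : R) : bounded_measurable (fun=> k).
Proof. by split=> //; exists `|k|. Qed.

Lemma bounded_measurable_indic A : measurable A -> bounded_measurable \1_A.
Proof.
by move=> mA; split=> //; exists 1 => w; rewrite indicE; case: (_ \in _);
  rewrite ?normr1 ?normr0.
Qed.

Lemma bounded_measurableD {f g} : bounded_measurable f -> bounded_measurable g ->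
  bounded_measurable (fun w => f w + g w).
Proof.
move=> [mf [M fM]] [mg [N gN]]; split; first exact: measurable_funD.
by exists (M + N) => w; rewrite (le_trans (ler_normD _ _))// lerD.
Qed.

Lemma bounded_measurableM {f g} : bounded_measurable f -> bounded_measurable g ->
  bounded_measurable (fun w => f w * g w).
Proof.
move=> [mf [M fM]] [mg [N gN]]; split; first exact: measurable_funM.
by exists (M * N) => w; rewrite normrM ler_pM.
Qed.

Lemma bounded_measurableZ (k : R) {f} : bounded_measurable f ->
  bounded_measurable (fun w => k * f w).
Proof. by move=> bf; apply: bounded_measurableM => //; exact: bounded_measurable_cst. Qed.

Lemma bounded_measurableB {f g} : bounded_measurable f -> bounded_measurable g ->
  bounded_measurable (fun w => f w - g w).
Proof.
move=> bf bg; rewrite (_ : (fun w => _) = fun w => f w + -1 * g w).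
  exact/bounded_measurableD/bounded_measurableZ.
by apply/funext => w; rewrite mulN1r.
Qed.

Lemma bounded_measurable_integrable {f} : bounded_measurable f ->
  P.-integrable [set: T] (EFin \o f).
Proof.
move=> [mf [M fM]]; apply: measurable_bounded_integrable => //.
  by rewrite (le_lt_trans (probability_le1 P _))// ltry.
exists M; split; first exact: num_real.
by move=> x Mx w _; exact: le_trans (fM w) (ltW Mx).
Qed.

Lemma mean_cst (k : R) : \int[P]_w k = k.
Proof. by rewrite Rintegral_cst// [fine _](congr1 fine (probability_setT P)) mulr1. Qed.

Lemma meanD f g : bounded_measurable f -> bounded_measurable g ->
  \int[P]_w (f w + g w) = \int[P]_w f w + \int[P]_w g w.
Proof. by move=> bf bg; rewrite RintegralD//; exact: bounded_measurable_integrable. Qed.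

Lemma meanB f g : bounded_measurable f -> bounded_measurable g ->
  \int[P]_w (f w - g w) = \int[P]_w f w - \int[P]_w g w.
Proof. by move=> bf bg; rewrite RintegralB//; exact: bounded_measurable_integrable. Qed.

Lemma meanZ (k : R) f : bounded_measurable f ->
  \int[P]_w (k * f w) = k * \int[P]_w f w.
Proof. by move=> bf; rewrite RintegralZl//; exact: bounded_measurable_integrable. Qed.

Lemma mean_indic A : measurable A -> \int[P]_w \1_A w = fine (P A).
Proof. by move=> mA; rewrite /Rintegral integral_indic// setIT. Qed.

Lemma le_mean f g : bounded_measurable f -> bounded_measurable g ->
  (forall w, f w <= g w) -> \int[P]_w f w <= \int[P]_w g w.
Proof. by move=> bf bg fg; apply: le_Rintegral => //; exact: bounded_measurable_integrable. Qed.

Lemma expectation_mean f : bounded_measurable f -> 'E_P[f] = (\int[P]_w f w)%:E.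
Proof.
move=> bf; rewrite unlock /Rintegral fineK//.
by apply: integrable_fin_num => //; exact: bounded_measurable_integrable.
Qed.

End bounded_measurable.
Arguments bounded_measurable_indic {d T} R {A}.

(** * Functions independent of a family of inputs *)

Section independent_of.
Context d (T : measurableType d) (R : realType) (P : probability T R).
Context (I : eqType) (F : I -> set_system T).
Hypothesis mF : forall i A, F i A -> measurable A.
Implicit Types (J : set I) (H G : T -> R).

(* Independence of [H] from the cylinders over [J] only: this suffices because every
   function used below is a polynomial in indicators of events of the [F i]. *)
Definition independent_of J H :=
  bounded_measurable H /\
  forall (s : seq I) (A : I -> set T),
    uniq s -> (forall i, i \in s -> J i) -> (forall i, i \in s -> F i (A i)) ->
    \int[P]_w (H w * \1_(\big[setI/setT]_(i <- s) A i) w) =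
    (\int[P]_w H w) * \prod_(i <- s) fine (P (A i)).

Let mcap (s : seq I) (A : I -> set T) :
  (forall i, i \in s -> F i (A i)) -> measurable (\big[setI/setT]_(i <- s) A i).
Proof.
move=> FA; rewrite big_seq.
by apply: big_ind => // [B C|i /FA /mF//]; exact: measurableI.
Qed.

Lemma independent_ofS {J J' H} : J' `<=` J -> independent_of J H -> independent_of J' H.
Proof.
by move=> JJ' [bH iH]; split=> // s A us sJ FA; apply: iH => // i /sJ /JJ'.
Qed.

(** The product rule for cylinders is exactly the claim for constants. Every other instance is built
    from constants by the closure properties below. *)
Lemma independent_of_cst J (k : R) : mutually_independent P J F ->
  independent_of J (fun=> k).
Proof.
move=> mi; split; first exact: bounded_measurable_cst.
move=> s A us sJ FA; rewrite meanZ; last exact/bounded_measurable_indic/mcap.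
rewrite mean_cst mean_indic; last exact: mcap.
rewrite mi// (eq_big_seq (fun i => (fine (P (A i)))%:E)) ?prodEFin// => i si.
by rewrite fineK// fin_num_measure//; exact: mF (FA _ si).
Qed.

Lemma independent_ofD {J H G} : independent_of J H -> independent_of J G ->
  independent_of J (fun w => H w + G w).
Proof.
move=> [bH iH] [bG iG]; split; first exact: bounded_measurableD.
move=> s A us sJ FA.
have b1 := bounded_measurable_indic R (mcap FA).
under eq_Rintegral do rewrite mulrDl.
rewrite !meanD//; try exact: bounded_measurableM.
by rewrite mulrDl iH// iG.
Qed.

Lemma independent_ofZ {J H} (k : R) : independent_of J H ->
  independent_of J (fun w => k * H w).
Proof.
move=> [bH iH]; split; first exact: bounded_measurableZ.
move=> s A us sJ FA.
have b1 := bounded_measurable_indic R (mcap FA).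
under eq_Rintegral do rewrite -mulrA.
rewrite !meanZ//; last exact: bounded_measurableM.
by rewrite iH// mulrA.
Qed.

Lemma independent_ofB {J H G} : independent_of J H -> independent_of J G ->
  independent_of J (fun w => H w - G w).
Proof.
move=> iH iG; rewrite (_ : (fun w => _) = fun w => H w + -1 * G w).
  exact/independent_ofD/independent_ofZ.
by apply/funext => w; rewrite mulN1r.
Qed.

Lemma mean_mul_indic {J H i B} : J i -> F i B -> independent_of J H ->
  \int[P]_w (H w * \1_B w) = (\int[P]_w H w) * fine (P B).
Proof.
move=> Ji FB [_ /(_ [:: i] (fun=> B))]; rewrite !big_seq1; apply => //.
- by move=> j; rewrite inE => /eqP ->.
- by move=> j; rewrite inE => /eqP ->.
Qed.

(** A cylinder over [J] without [i], intersected with [B], is a cylinder over [J], to which the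
    independence of [H] applies. The price is that input [i] is used up. *)
Lemma independent_of_mul_indic {J H i B} : J i -> F i B -> independent_of J H ->
  independent_of (J `\ i) (fun w => H w * \1_B w).
Proof.
move=> Ji FB iJH; have [bH iH] := iJH.
have bB := bounded_measurable_indic R (mF FB).
split; first exact: bounded_measurableM.
move=> s A us sJ FA; rewrite (mean_mul_indic Ji FB)//.
(* [A'] merges [B] and the sets [A j] into one family over [i :: s], which is duplicate-free because
   [s] avoids [i]. *)
pose A' j := if j == i then B else A j.
have A'E j : j \in s -> A' j = A j.
  by move=> /sJ[_ /eqP/negbTE ji]; rewrite /A' ji.
have A'i : A' i = B by rewrite /A' eqxx.
have PA' : \prod_(j <- s) fine (P (A' j)) = \prod_(j <- s) fine (P (A j)).
  by apply: eq_big_seq => j /A'E ->.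
rewrite -mulrA -PA' -[in RHS]A'i -(eq_big_seq _ A'E).
have := iH (i :: s) A'; rewrite !big_cons => <-.
- by apply: eq_Rintegral => w _; rewrite A'i indicI -mulrA.
- by rewrite /= us andbT; apply/negP => /sJ[_]; exact.
- by move=> j; rewrite inE => /predU1P[->//|/sJ[]].
- by move=> j; rewrite inE => /predU1P[->|js]; rewrite ?A'i ?A'E//; exact: FA.
Qed.

End independent_of.

(** * Choice between two functions decided by a fresh input *)

Definition select d (T : measurableType d) (R : realType) (A : set T) (f g : T -> R) w :=
  if w \in A then f w else g w.

Section select.
Context d (T : measurableType d) (R : realType) (P : probability T R).
Context (I : eqType) (F : I -> set_system T).
Hypothesis mF : forall i A, F i A -> measurable A.

Lemma independent_of_select {J : set I} {i A} {f g : T -> R} : J i -> F i A ->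
  independent_of P F J f -> independent_of P F J g ->
  independent_of P F (J `\ i) (select A f g) /\
  \int[P]_w select A f g w =
    fine (P A) * \int[P]_w f w + (1 - fine (P A)) * \int[P]_w g w.
Proof.
move=> Ji FA iJf iJg.
(* As a polynomial in the indicator of [A], the choice falls under the closure properties. *)
have -> : select A f g = fun w => f w * \1_A w + (g w - g w * \1_A w).
  by apply/funext => w; rewrite /select indicE; case: (w \in A) => /=; ring.
have JJ : J `\ i `<=` J by move=> j [].
have fA := independent_of_mul_indic mF Ji FA iJf.
have gA := independent_of_mul_indic mF Ji FA iJg.
have g' := independent_ofS JJ iJg.
split; first by apply: independent_ofD => //; apply: independent_ofB.
have [[bfA _] [bgA _] [bg _]] := And3 fA gA iJg.
rewrite meanD//; last exact: bounded_measurableB.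
rewrite meanB// !(mean_mul_indic Ji FA)//; ring.
Qed.

End select.

(** * The steps relative to X_1: recursion for the means and second-moment bound *)

Section relative_walk.
Context d (Omega : measurableType d) (R : realType) (P : probability Omega R).
Variables (p : R) (X : nat -> {RV P >-> R}) (K : nat -> {RV P >-> nat})
  (e : nat -> {RV P >-> R}).
Hypotheses (p01 : 0 < p < 1) (erwX : erw_first_and_last p X K e).

Let recall_first n : set Omega := [set w | K n w = 1%N].
Let sign_pos n : set Omega := [set w | e n w = 1].

(* [relative_step n] is X_(n+1) / X_1, up to a null event. *)
Fixpoint relative_step (n : nat) : Omega -> R :=
  if n is m.+1 then
    let recalled := select (recall_first m.+1) (cst 1) (relative_step m) in
    select (sign_pos m.+2) recalled (fun w => - recalled w)
  else cst 1.

Lemma relative_step_sqr n w : relative_step n w * relative_step n w = 1.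
Proof.
elim: n => [|n IH] /=; first by rewrite mulr1.
by rewrite /select; do 2 case: ifP => _; rewrite ?mulrNN ?mulr1.
Qed.

Lemma normr_relative_step n w : `|relative_step n w| = 1.
Proof.
apply/eqP; rewrite -sqrp_eq1//; apply/eqP.
by rewrite expr2 -normrM relative_step_sqr normr1.
Qed.

Let F := erw_input_events X K e.

Let mF i A : F i A -> measurable A.
Proof. by case: i => [[n|n]|] /= [B mB <-]; apply: measurable_funPT. Qed.

(* Inputs that do not enter X_1, ..., X_(n+1), X_1 itself being left out. *)
Let future n : set (option (nat + nat)) :=
  [set i | match i with
           | None => False
           | Some (inl k) => (n < k)%N && (2 <= k)%N
           | Some (inr k) => (n.+1 < k)%N
           end].

Let ind n := independent_of P F (future n).

Let ind_cst n k : ind n (fun=> k).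
Proof.
apply: independent_of_cst => // s A us sJ; apply: (erw_independent erwX) => //.
by move=> [[i|i]|] /sJ //= => [/andP[]//|]; apply: leq_trans.
Qed.

(** The mean [2 * p - 1] of a sign times the probability 1/2 of each recall. *)
Let drift := p - 2^-1.

(** The index decides between [H * 1] and [H * relative_step n], hence the two hypotheses; the sign
    then decides between the outcome and its opposite. Both inputs are fresh, and removing them from
    [future n] leaves a set that contains [future n.+1]. *)
Let ind_step n H : ind n H -> ind n (fun w => H w * relative_step n w) ->
  ind n.+1 (fun w => H w * relative_step n.+1 w) /\
  \int[P]_w (H w * relative_step n.+1 w) =
    drift * (\int[P]_w H w + \int[P]_w (H w * relative_step n w)).
Proof.
move=> iH iHY.
(* [M] is [H] times the recalled step, before the sign is applied. *)
pose M w := H w * select (recall_first n.+1) (cst 1) (relative_step n) w.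
have [iM EM] : independent_of P F (future n `\ Some (inl n.+1)) M /\
    \int[P]_w M w = 2^-1 * (\int[P]_w H w + \int[P]_w (H w * relative_step n w)).
  have -> : M = select (recall_first n.+1) H (fun w => H w * relative_step n w).
    by apply/funext => w; rewrite /M /select; case: ifP; rewrite //= mulr1.
  (* For [n = 0] the choice is made by [K 1], whose law is not prescribed; both alternatives equal
     [H] because [relative_step 0] is 1. *)
  case: n iH iHY {M} => [|n] iH iHY.
    have -> : select (recall_first 1) H (fun w => H w * relative_step 0 w) = H.
      by apply/funext => w; rewrite /select/= mulr1 if_same.
    split; first by apply: independent_ofS iH => i [].
    under [X in _ = _ * (_ + X)]eq_Rintegral do rewrite mulr1.
    by field.
  have Jn : future n.+1 (Some (inl n.+2)) by rewrite /future /= ltnSn.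
  have FA : F (Some (inl n.+2)) (recall_first n.+2).
    by exists [set 1%N] => //; rewrite setTI.
  have [? ->] := independent_of_select mF Jn FA iH iHY; split=> //.
  by rewrite (erw_index_first erwX)//=; field.
have Jn : (future n `\ Some (inl n.+1)) (Some (inr n.+2)).
  by split => //; rewrite /future /= ltnSn.
have FA : F (Some (inr n.+2)) (sign_pos n.+2).
  by exists [set 1] => //; rewrite setTI.
have iN := independent_ofZ mF (-1) iM.
have := independent_of_select mF Jn FA iM iN.
have -> : select (sign_pos n.+2) M (fun w => -1 * M w) =
    fun w => H w * relative_step n.+1 w.
  by apply/funext => w; rewrite /select /M /= /select; case: (w \in sign_pos _) => //; ring.
move=> [iS ->]; split.
  apply: independent_ofS iS => -[[k|k]|]//= nk; split; [split| |split|]; rewrite /=.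
  - by case/andP: nk => /ltnW -> ->.
  - by move=> [kn]; rewrite kn ltnn in nk.
  - by [].
  - exact: ltnW.
  - by [].
  - by move=> [kn]; rewrite kn ltnn in nk.
rewrite (erw_sign_pos erwX)//= meanZ; last by case: iM.
by rewrite EM /drift; field.
Qed.

Definition limit_ratio : R := (2 * p - 1) / (3 - 2 * p).
Let c := limit_ratio.

Let fixpoint_c : c = drift * (1 + c).
Proof.
have q0 : 3 - 2 * p != 0 by rewrite gt_eqF//; move: p01; lra.
by rewrite /c /limit_ratio /drift; field.
Qed.

Lemma normr_limit_ratio : `|c| <= 1.
Proof.
have q0 : 0 < 3 - 2 * p by move: p01; lra.
by rewrite ler_norml /c /limit_ratio ler_pdivlMr// ler_pdivrMr//; move: p01; lra.
Qed.

(** [relative_step k] is Y_(k+1), so this is W_(n+1), with [n.+1] terms. *)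
Definition deviation n w := \sum_(k < n.+1) (relative_step k w - c).

Let deviationS n w : deviation n.+1 w = deviation n w + (relative_step n.+1 w - c).
Proof. by rewrite /deviation big_ord_recr. Qed.

Let ind_relative_step n : ind n (relative_step n).
Proof.
elim: n => [|n IH]; first exact: ind_cst.
have [//||+ _] := @ind_step n (cst 1).
- exact: ind_cst.
- by rewrite (_ : (fun=> _) = relative_step n)//; apply/funext => w; rewrite mul1r.
- by rewrite (_ : (fun=> _) = relative_step n.+1)//; apply/funext => w; rewrite mul1r.
Qed.

(** The two claims are carried together because [ind_step] with [H] the deviation takes both. As
    Y_(n+1) squares to 1, the product of the new deviation with the new step is linear in functions
    already known to be independent of the future. *)
Let ind_deviation n :
  ind n (deviation n) /\ ind n (fun w => deviation n w * relative_step n w).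
Proof.
elim: n => [|n [iD iDY]].
  have -> : deviation 0 = fun=> 1 - c.
    by apply/funext => w; rewrite /deviation big_ord1.
  split; first exact: ind_cst.
  by rewrite (_ : (fun=> _) = fun=> (1 - c) * 1)//; exact: ind_cst.
have fS : future n.+1 `<=` future n.
  by move=> [[k|k]|]//=; [move=> /andP[/ltnW -> ->]|exact: ltnW].
have [iDS _] := ind_step iD iDY.
have iY := ind_relative_step n.+1.
split.
  rewrite (funext (deviationS n)).
  apply: (independent_ofD mF); first exact: independent_ofS iD.
  exact: (independent_ofB mF iY (ind_cst _ c)).
rewrite (_ : (fun w => _) =
    fun w => deviation n w * relative_step n.+1 w + (1 - c * relative_step n.+1 w)).
  apply: (independent_ofD mF) => //; apply: (independent_ofB mF (ind_cst _ 1)).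
  exact: (independent_ofZ mF).
apply/funext => w; rewrite deviationS mulrDl mulrBl.
by rewrite relative_step_sqr.
Qed.

Lemma bounded_relative_step n : bounded_measurable (relative_step n).
Proof. by case: (ind_relative_step n). Qed.

Lemma bounded_deviation n : bounded_measurable (deviation n).
Proof. by case: (ind_deviation n) => -[]. Qed.

Let bounded_centered n : bounded_measurable (fun w => relative_step n w - c).
Proof.
by apply: bounded_measurableB (bounded_relative_step n) _; exact: bounded_measurable_cst.
Qed.

(** Both terms of the difference lie in [-1, 1], and [4] is [(1 + 1) ^ 2]. *)
Let centered_sqr_le n w : (relative_step n w - c) * (relative_step n w - c) <= 4.
Proof.
have := normr_relative_step n w; have := normr_limit_ratio.
rewrite ler_norml -/c => /andP[? ?] /eqP; rewrite eqr_norml ler01 andbT => /orP[] /eqP ->; nra.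
Qed.

Let mean_centered_sqr n :
  0 <= \int[P]_w ((relative_step n w - c) * (relative_step n w - c)) <= 4.
Proof.
have b := bounded_measurableM (bounded_centered n) (bounded_centered n).
apply/andP; split; first by apply: Rintegral_ge0 => w _; rewrite -expr2 sqr_ge0.
by rewrite -(mean_cst P 4); apply: le_mean => //; exact: bounded_measurable_cst.
Qed.

Let cov n := \int[P]_w (deviation n w * (relative_step n w - c)).

Let mean_deviation_next n :
  \int[P]_w (deviation n w * (relative_step n.+1 w - c)) = drift * cov n.
Proof.
have [iD iDY] := ind_deviation n; have [[bDS _] EDS] := ind_step iD iDY.
have [bD _] := iD; have [bDY _] := iDY.
have bcD : bounded_measurable (fun w => c * deviation n w) by exact: bounded_measurableZ.
rewrite /cov.
under eq_Rintegral do rewrite mulrBr [_ * c]mulrC.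
under [in RHS]eq_Rintegral do rewrite mulrBr [_ * c]mulrC.
(* With D the deviation and Y the current step, the left side is
   [drift * (E D + E (D Y)) - c * E D]. Replacing [c] by [drift * (1 + c)] cancels the lone
   [drift * E D]. *)
rewrite !meanB// meanZ// EDS [in LHS]fixpoint_c; ring.
Qed.

Let normr_drift : `|drift| <= 2^-1.
Proof. by rewrite ler_norml /drift; move: p01; lra. Qed.

(* [8] is the fixed point of [t |-> t / 2 + 4]. *)
Let normr_cov_le n : `|cov n| <= 8.
Proof.
elim: n => [|n IH].
  have -> : cov 0 = \int[P]_w ((relative_step 0 w - c) * (relative_step 0 w - c)).
    by apply: eq_Rintegral => w _; rewrite /deviation big_ord1.
  by have /andP[? ?] := mean_centered_sqr 0; rewrite ger0_norm//; lra.
have -> : cov n.+1 = drift * cov n +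
    \int[P]_w ((relative_step n.+1 w - c) * (relative_step n.+1 w - c)).
  rewrite -mean_deviation_next -meanD//; try exact: bounded_measurableM (bounded_centered _).
    by apply: eq_Rintegral => w _; rewrite deviationS mulrDl.
  exact: bounded_measurableM (bounded_deviation _) (bounded_centered _).
have /andP[? ?] := mean_centered_sqr n.+1.
rewrite (le_trans (ler_normD _ _))// [X in _ + X]ger0_norm// normrM.
have := ler_pM (normr_ge0 _) (normr_ge0 _) normr_drift IH; lra.
Qed.

(** Expanding the square, each step adds [2 * (drift * cov n)], at most [2 * 4], and a mean square
    of at most 4: in all 12. *)
Lemma mean_deviation_sqr n : \int[P]_w (deviation n w * deviation n w) <= 12 * n.+1%:R.
Proof.
elim: n => [|n IH].
  have -> : \int[P]_w (deviation 0 w * deviation 0 w) =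
      \int[P]_w ((relative_step 0 w - c) * (relative_step 0 w - c)).
    by apply: eq_Rintegral => w _; rewrite /deviation big_ord1.
  have /andP[? ?] := mean_centered_sqr 0; lra.
have bD := bounded_deviation n; have bZ := bounded_centered n.+1.
have bDD := bounded_measurableM bD bD; have bDZ := bounded_measurableM bD bZ.
have bZZ := bounded_measurableM bZ bZ.
have -> : \int[P]_w (deviation n.+1 w * deviation n.+1 w) =
    \int[P]_w (deviation n w * deviation n w) +
    (2 * (drift * cov n) +
    \int[P]_w ((relative_step n.+1 w - c) * (relative_step n.+1 w - c))).
  rewrite -mean_deviation_next -meanZ// -meanD//; last exact: bounded_measurableZ.
  rewrite -meanD//; last by apply: bounded_measurableD => //; exact: bounded_measurableZ.
  by apply: eq_Rintegral => w _; rewrite deviationS; ring.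
have /andP[? ?] := mean_centered_sqr n.+1.
have : drift * cov n <= 4.
  rewrite (le_trans (ler_norm _))// normrM.
  have := ler_pM (normr_ge0 _) (normr_ge0 _) normr_drift (normr_cov_le n); lra.
rewrite -[n.+2%:R]natr1; lra.
Qed.

End relative_walk.

(** * From the relative walk to S_n/n, up to null events *)

Lemma ae_setU_probability1 d (T : measurableType d) (R : realType)
    (P : probability T R) (A B : set T) (p : R) :
  measurable A -> measurable B -> A `&` B = set0 ->
  P A = p%:E -> P B = (1 - p)%:E -> {ae P, forall w, A w \/ B w}.
Proof.
move=> mA mB AB PA PB; have mAB := measurableU _ _ mA mB.
exists (~` (A `|` B)); split; [exact: measurableC| |by []].
rewrite probability_setC// measureU// [X in (_ - (X + _))%E]PA [X in (_ - (_ + X))%E]PB.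
by rewrite -EFinD subrKC subrr.
Qed.

Section walk_limit.
Context d (Omega : measurableType d) (R : realType) (P : probability Omega R).
Variables (p : R) (X : nat -> {RV P >-> R}) (K : nat -> {RV P >-> nat})
  (e : nat -> {RV P >-> R}).
Hypotheses (p01 : 0 < p < 1) (erwX : erw_first_and_last p X K e).

Let Y := relative_step K e.
Let c := limit_ratio p.

Let first_pos : set Omega := [set w | X 1 w = 1].
(** A version of X_1 with values 1 and -1 everywhere, not just almost surely. *)
Let first_sign : Omega -> R := select first_pos (cst 1) (cst (-1)).

Let first_signE w : first_sign w = 1 \/ first_sign w = -1.
Proof. by rewrite /first_sign /select; case: ifP; [left|right]. Qed.

Let measurable_eq d' (U : measurableType d') (f : {mfun Omega >-> U}) u :
  measurable [set u] -> measurable [set w | f w = u].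
Proof. by move=> /(measurable_funPT f measurableT); rewrite setTI. Qed.

(** Outside countably many null events, X_1, all signs and all indices take one of their two
    prescribed values; there the recursions of [X] and of [relative_step] agree. *)
Let ae_stepE : {ae P, forall w, forall n, X n.+1 w = first_sign w * Y n w}.
Proof.
have disj U (f : Omega -> U) u v : u <> v -> [set w | f w = u] `&` [set w | f w = v] = set0.
  by move=> uv; apply/seteqP; split=> // w [/= -> /uv].
have n11 : (1 : R) <> -1 by move=> /eqP; rewrite -addr_eq0 gt_eqF.
have ae1 : {ae P, forall w, X 1 w = 1 \/ X 1 w = -1}.
  apply: (@ae_setU_probability1 _ _ _ _ [set w | X 1 w = 1] [set w | X 1 w = -1] p).
  - exact: measurable_eq.
  - exact: measurable_eq.
  - exact: disj.
  - exact: erw_first_pos erwX.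
  - exact: erw_first_neg erwX.
have ae2 : {ae P, forall w, forall n, e n.+2 w = 1 \/ e n.+2 w = -1}.
  apply: ae_foralln => n.
  apply: (@ae_setU_probability1 _ _ _ _ [set w | e n.+2 w = 1] [set w | e n.+2 w = -1] p).
  - exact: measurable_eq.
  - exact: measurable_eq.
  - exact: disj.
  - exact: erw_sign_pos erwX _ _.
  - exact: erw_sign_neg erwX _ _.
have ae3 : {ae P, forall w, forall n, K n.+2 w = 1%N \/ K n.+2 w = n.+2}.
  apply: ae_foralln => n.
  apply: (@ae_setU_probability1 _ _ _ _
    [set w | K n.+2 w = 1%N] [set w | K n.+2 w = n.+2] 2^-1).
  - exact: measurable_eq.
  - exact: measurable_eq.
  - exact: disj.
  - exact: erw_index_first erwX _ _.
  - by rewrite (erw_index_last erwX)//; congr EFin; field.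
move: ae1 ae2 ae3; apply: filterS3 => w X1 e2 K2.
have s1 : X 1 w = first_sign w.
  rewrite /first_sign /select; case: ifPn; first by rewrite inE.
  by case: X1 => // + /negP; rewrite inE.
have signE m (u : Omega -> R) :
    select [set w | e m.+2 w = 1] u (fun w => - u w) w = e m.+2 w * u w.
  rewrite /select; case: ifPn => [|/negP]; rewrite inE /=; first by move=> ->; rewrite mul1r.
  by case: (e2 m) => // ->; rewrite mulN1r.
elim=> [|n IH]; first by rewrite /Y /= mulr1.
(* The second step obeys its own rule without an index; the corresponding [select] has equal
   branches. *)
rewrite /Y /= signE mulrCA; case: n IH => [|n] IH.
  by rewrite (erw_second erwX) s1 /select if_same mulr1.
rewrite (erw_step erwX)//; congr (_ * _).
rewrite /select; case: ifPn => [|/negP]; rewrite inE /=.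
  by move=> ->; rewrite mulr1.
by case: (K2 n) => // -> _; rewrite IH.
Qed.

(* S_n / n up to a null event, but bounded by 1 everywhere. *)
Let model_mean n w := first_sign w * ((\sum_(k < n) Y k w) / n%:R).

Let ae_walk_meanE : {ae P, forall w, forall n, walk_mean X n w = model_mean n w}.
Proof.
move: ae_stepE; apply: filterS => w XE n.
rewrite /walk_mean /walk /model_mean mulrA; congr (_ / _).
rewrite big_add1 /= big_mkord mulr_sumr.
by apply: eq_bigr => i _; rewrite XE.
Qed.

Let normr_model_mean_le1 n w : `|model_mean n w| <= 1.
Proof.
rewrite /model_mean normrM (_ : `|first_sign w| = 1) ?mul1r; last first.
  by case: (first_signE w) => ->; rewrite ?normrN normr1.
case: n => [|n]; first by rewrite big_ord0 mul0r normr0.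
rewrite normrM normfV normr_nat ler_pdivrMr ?ltr0n// mul1r.
rewrite (le_trans (ler_norm_sum _ _ _))//.
rewrite (eq_bigr (fun=> 1)); last by move=> i _; exact: normr_relative_step.
by rewrite sumr_const card_ord.
Qed.

Lemma ae_normr_walk_mean_le1 :
  {ae P, forall w, forall n, (0 < n)%N -> `|walk_mean X n w| <= 1}.
Proof. by move: ae_walk_meanE; apply: filterS => w meanE n _; rewrite meanE. Qed.

Let mfirst : measurable first_pos. Proof. exact: measurable_eq. Qed.

Let bfirst : bounded_measurable first_sign.
Proof.
have -> : first_sign = fun w => 2 * \1_first_pos w - 1.
  by apply/funext => w; rewrite /first_sign /select indicE; case: (w \in _) => /=; ring.
apply: bounded_measurableB; last exact: bounded_measurable_cst.
exact/bounded_measurableZ/bounded_measurable_indic.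
Qed.

Let model_mean_sub n w :
  model_mean n.+1 w - first_sign w * c = first_sign w * (deviation p K e n w / n.+1%:R).
Proof.
rewrite -mulrBr; congr (_ * _).
rewrite /deviation sumrB sumr_const card_ord mulrBl -/c; congr (_ - _).
by rewrite -[c *+ _]mulr_natr mulfK.
Qed.

Let bmodel n : bounded_measurable (model_mean n.+1).
Proof.
have -> : model_mean n.+1 = fun w => first_sign w * (c + (n.+1%:R)^-1 * deviation p K e n w).
  by apply/funext => w; rewrite -[LHS](subrK (first_sign w * c)) model_mean_sub; ring.
apply: bounded_measurableM => //.
apply: bounded_measurableD; first exact: bounded_measurable_cst.
exact/bounded_measurableZ/(bounded_deviation erwX).
Qed.

(** The sign of X_1 squares to 1 and disappears; what remains is [12 * n.+1] divided by the square
    of [n.+1]. *)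
Let mean_model_sqr n :
  \int[P]_w ((model_mean n.+1 w - first_sign w * c) *
              (model_mean n.+1 w - first_sign w * c)) <= 12 / n.+1%:R.
Proof.
have n0 : 0 < n.+1%:R :> R by rewrite ltr0n.
under eq_Rintegral => w _.
  rewrite model_mean_sub (_ : _ * _ =
    (n.+1%:R^-1 ^+ 2) * (deviation p K e n w * deviation p K e n w)); last first.
    by case: (first_signE w) => ->; ring.
  over.
have bD := bounded_deviation erwX n.
rewrite meanZ//; last exact: bounded_measurableM.
rewrite exprVn -ler_pdivlMl ?invr_gt0 ?exprn_gt0// invrK.
rewrite (le_trans (mean_deviation_sqr p01 erwX n))//.
by rewrite le_eqVlt; apply/orP; left; apply/eqP; field; rewrite gt_eqF.
Qed.

Context d' (Omega' : measurableType d') (P' : probability Omega' R) (S : {RV P' >-> R}).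
Hypothesis lawS : equals_pm p c S.

Let ae_limitE : {ae P', forall w, S w = c \/ S w = - c}.
Proof.
have m2 : measurable [set c; - c] by exact: measurableU.
exists (S @^-1` (~` [set c; - c])); split=> //.
  by rewrite -[S @^-1` _]setTI; apply: (measurable_funPT S) => //; exact: measurableC.
have := lawS (measurableC m2); rewrite /distribution /pushforward => ->.
have Nc : ~ (~` [set c; - c]) c by apply; left.
have NNc : ~ (~` [set c; - c]) (- c) by apply; right.
by rewrite !diracE !memNset// !mule0 adde0.
Qed.

(** * Expectations of test functions bounded on [-1, 1] and continuous at the two limit values *)

Section bounded_test_function.
Variables (f : R -> R) (M : R).
Hypotheses (mf : measurable_fun [set: R] f) (fM : forall x, `|x| <= 1 -> `|f x| <= M).

Let b_comp dT (T : measurableType dT) (g : T -> R) :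
  bounded_measurable g -> (forall w, `|g w| <= 1) -> bounded_measurable (f \o g).
Proof.
by move=> [mg _] g1; split; [exact: measurableT_comp|exists M => w; exact: fM].
Qed.

Let expectation_limit : 'E_P'[f \o S] = (p * f c + (1 - p) * f (- c))%:E.
Proof.
have c1 : `|c| <= 1 := normr_limit_ratio p01.
(* Removing [c] makes [A] empty when [c = - c], so that one formula also covers coinciding limit
   values. *)
pose A := S @^-1` ([set - c] `\ c).
have mA : measurable A.
  rewrite /A -[S @^-1` _]setTI; apply: (measurable_funPT S) => //.
  exact: measurableD.
have PA : P' A = ((1 - p) * (- c != c)%:R)%:E.
  rewrite [LHS](lawS _); last exact: measurableD.
  rewrite !diracE; have [cc|/eqP cc] := eqVneq (- c) c.
    by rewrite !memNset ?mule0 ?mulr0 ?adde0//= => -[].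
  by rewrite memNset ?mem_set ?mule1 ?mule0 ?mulr1 ?add0e//= => -[] //; apply.
have bg : bounded_measurable (fun w => f c + (f (- c) - f c) * \1_A w).
  apply: bounded_measurableD; first exact: bounded_measurable_cst.
  exact/bounded_measurableZ/bounded_measurable_indic.
transitivity 'E_P'[fun w => f c + (f (- c) - f c) * \1_A w].
  rewrite unlock; apply: ae_eq_integral => //.
  - exact/measurable_EFinP/measurableT_comp.
  - by apply/measurable_EFinP; case: bg.
  move: ae_limitE; apply: filterS => w Sw _ /=; congr EFin; rewrite indicE.
  have [cc|/eqP cc] := eqVneq (- c) c.
    by rewrite cc subrr mul0r addr0; case: Sw => ->; rewrite ?cc.
  case: Sw => Sw; rewrite Sw.
  - by rewrite memNset ?mulr0 ?addr0// /A /= Sw => -[] _; apply.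
  - by rewrite mem_set ?mulr1 1?addrC ?subrK// /A /= Sw.
rewrite expectation_mean// meanD//; last 2 first.
- exact: bounded_measurable_cst.
- exact/bounded_measurableZ/bounded_measurable_indic.
rewrite meanZ; last exact: bounded_measurable_indic.
rewrite mean_cst mean_indic// [P' A]PA /=; congr EFin.
by case: eqVneq => [->|_] /=; ring.
Qed.

Hypotheses (fc : {for c, continuous f}) (fNc : {for - c, continuous f}).

(** Chebyshev's argument in pointwise form: near the limit value continuity gives [eps], and far
    from it the bound on [f] is absorbed by a multiple of the squared distance. [B] depends neither
    on [w] nor on [n]. *)
Let approx eps : 0 < eps -> exists B, forall w n,
  `|f (model_mean n w) - f (first_sign w * c)| <=
  eps + B * ((model_mean n w - first_sign w * c) * (model_mean n w - first_sign w * c)).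
Proof.
move=> e0.
have c1 : `|c| <= 1 := normr_limit_ratio p01.
have M0 : 0 <= M by apply: le_trans (fM c1).
suff loc z : {for z, continuous f} -> `|z| <= 1 -> exists2 B, 0 <= B & forall y, `|y| <= 1 ->
    `|f y - f z| <= eps + B * ((y - z) * (y - z)).
  have [B1 B10 h1] := loc _ fc c1.
  have [|B2 B20 h2] := loc _ fNc; first by rewrite normrN.
  (* The sum of two nonnegative constants serves both limit values. *)
  exists (B1 + B2) => w n; case: (first_signE w) => ->; rewrite ?mul1r ?mulN1r mulrDl.
  - rewrite (le_trans (h1 _ (normr_model_mean_le1 n w)))// lerD2l.
    by rewrite lerDl -expr2 mulr_ge0 ?sqr_ge0.
  - rewrite (le_trans (h2 _ (normr_model_mean_le1 n w)))// lerD2l.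
    by rewrite lerDr -expr2 mulr_ge0 ?sqr_ge0.
move=> fz z1; have /cvgrPdist_le /(_ _ e0) /nbhs_ballP[dl /= dl0 fdl] := fz.
(* At distance at least [dl], the difference of values is at most [2 * M] while the squared distance
   over [dl ^+ 2] is at least 1. *)
exists (2 * M / dl ^+ 2); first by rewrite divr_ge0 ?sqr_ge0// mulr_ge0.
move=> y y1; rewrite -expr2.
have [yz|zy] := ltP `|z - y| dl.
  rewrite distrC (le_trans (fdl y yz))// lerDl mulr_ge0 ?sqr_ge0//.
  by rewrite divr_ge0 ?sqr_ge0// mulr_ge0.
rewrite (le_trans (ler_normB _ _))// (le_trans (lerD (fM y1) (fM z1)))//.
have far : 1 <= (dl ^+ 2)^-1 * (y - z) ^+ 2.
  rewrite ler_pdivlMl ?exprn_gt0// mulr1 -[leRHS]real_normK ?num_real//.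
  by rewrite distrC lerXn2r ?nnegrE ?(ltW dl0).
have M20 : 0 <= 2 * M by rewrite mulr_ge0.
rewrite -mulrA; have := ler_wpM2l M20 far; move: e0; lra.
Qed.

(** Integrating [approx] bounds the error by half of [eps] plus a multiple of the mean square, which
    is O(1/n). *)
Lemma expectation_walk_mean_cvg :
  'E_P[fun w => f (walk_mean X n w)] @[n --> \oo] --> 'E_P'[f \o S].
Proof.
have c1 : `|c| <= 1 := normr_limit_ratio p01.
have bfmodel n : bounded_measurable (f \o model_mean n.+1) by exact: b_comp.
pose g w := first_sign w * c.
have bg : bounded_measurable g.
  by apply: bounded_measurableM => //; exact: bounded_measurable_cst.
have g1 w : `|g w| <= 1.
  by rewrite /g; case: (first_signE w) => ->; rewrite ?mul1r ?mulN1r ?normrN.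
have bfg : bounded_measurable (f \o g) by exact: b_comp.
(* [S] lives on another probability space; its expectation is transported to [g], that is c X_1,
   which has the same law. *)
have -> : 'E_P'[f \o S] = (\int[P]_w f (g w))%:E.
  rewrite expectation_limit; congr EFin.
  have -> : (fun w => f (g w)) = fun w => f (- c) + (f c - f (- c)) * \1_first_pos w.
    apply/funext => w; rewrite /g /first_sign /select indicE; case: (w \in _) => /=.
      by rewrite mul1r mulr1 addrC subrK.
    by rewrite mulN1r mulr0 addr0.
  have b1 : bounded_measurable (\1_first_pos : _ -> R) by exact: bounded_measurable_indic.
  rewrite meanD; [|exact: bounded_measurable_cst|exact: bounded_measurableZ].
  rewrite meanZ// mean_cst mean_indic// (erw_first_pos erwX)/=; ring.
(* The shift discards the index 0 and matches the bounds, which are stated for [n.+1]. *)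
rewrite -(cvg_shiftn 1) /=.
have -> : (fun n => 'E_P[fun w => f (walk_mean X (n + 1) w)]) =
    EFin \o (fun n => \int[P]_w f (model_mean n.+1 w)).
  apply/funext => n /=; rewrite addn1 -expectation_mean; last exact: bfmodel.
  rewrite unlock; apply: ae_eq_integral => //.
  - apply/measurable_EFinP/measurableT_comp => //; exact: measurable_walk_mean.
  - by apply/measurable_EFinP; case: (bfmodel n).
  by move: ae_walk_meanE; apply: filterS => w meanE _ /=; rewrite meanE.
apply: cvg_EFin; first exact: nearW.
apply/cvgrPdist_le => eps e0.
have e20 : 0 < eps / 2 by rewrite divr_gt0.
have [B fB] := approx e20.
(* [approx] does not give the sign of [B], hence the absolute value. *)
have : (`|B| * 12) / n.+1%:R @[n --> \oo] --> (0 : R).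
  rewrite -[X in _ --> X](mulr0 (`|B| * 12)); apply: cvgMr.
  exact: cvg_harmonic.
move=> /cvgrPdist_le /(_ (eps / 2)); move=> /(_ e20).
apply: filterS => n; rewrite sub0r normrN ger0_norm; last by rewrite divr_ge0 ?mulr_ge0.
move=> nB.
pose D w := (model_mean n.+1 w - g w) * (model_mean n.+1 w - g w).
have bD : bounded_measurable D by apply: bounded_measurableM; exact: bounded_measurableB.
rewrite distrC -meanB; [|exact: bfmodel|exact: bfg].
apply: (@le_trans _ _ (\int[P]_w (eps / 2 + B * D w))).
  have bR : bounded_measurable (fun w => eps / 2 + B * D w).
    by apply: bounded_measurableD; [exact: bounded_measurable_cst|exact: bounded_measurableZ].
  have bfd := bounded_measurableB (bfmodel n) bfg.
  apply: le_trans (le_normr_Rintegral measurableT (bounded_measurable_integrable P bfd)) _.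
  apply: le_mean => // [|w]; last exact: fB.
  have [m [N mN]] := bfd.
  by split; [exact: measurableT_comp|exists N => w; rewrite normr_id].
rewrite meanD; [|exact: bounded_measurable_cst|exact: bounded_measurableZ].
rewrite mean_cst meanZ// [leRHS](splitr eps) lerD2l.
apply: le_trans nB; apply: (@le_trans _ _ (`|B| * \int[P]_w D w)).
  by rewrite ler_wpM2r ?ler_norm//; apply: Rintegral_ge0 => w _; rewrite /D -expr2 sqr_ge0.
by rewrite -mulrA ler_wpM2l//; exact: mean_model_sqr.
Qed.

End bounded_test_function.
End walk_limit.

(** * Continuity and bounds of the real and imaginary parts of the power *)

Lemma continuous_pos_powR (R : realType) (r : R) : 0 < r ->
  continuous (fun x : R => Num.max x 0 `^ r).
Proof.
move=> r0 x; have [x0|x0|<-] := ltgtP 0 x.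
- have cvx : y `^ r @[y --> x] --> x `^ r.
    have dx : derivable (@powR R ^~ r) x 1 by apply: derivable_powR; rewrite in_itv/= x0.
    by move: dx => /derivable1_diffP/differentiable_continuous; exact.
  rewrite /continuous_at (max_idPl (ltW x0)); apply: cvg_trans cvx.
  apply: near_eq_cvg; near=> y; rewrite /= (max_idPl _)//.
  by near: y; apply: (cvgr_ge x cvg_id).
- rewrite /continuous_at; apply: cvg_near_cst; near=> y.
  rewrite !(max_idPr _)//; first exact: ltW.
  by near: y; apply: (cvgr_le x cvg_id).
(* At 0 the value is 0 because [r] is positive, and the power is below [eps] once the base is below
   [eps] to the power [1 / r]. *)
- rewrite /continuous_at maxxx powR0 ?gt_eqF//.
  apply/cvgrPdist_lt => eps e0; near=> y.
  rewrite sub0r normrN ger0_norm ?powR_ge0//.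
  have -> : eps = (eps `^ r^-1) `^ r by rewrite -powRrM mulVf ?gt_eqF// powRr1// ltW.
  rewrite gt0_ltr_powR ?nnegrE ?powR_ge0 ?le_max ?lexx ?orbT//.
  rewrite gt_max powR_gt0// andbT.
  by near: y; apply: (cvgr_lt 0 cvg_id); exact: powR_gt0.
Unshelve. all: by end_near. Qed.

Section complex_power.
Context (R : realType) (r : R).
Hypothesis r0 : 0 < r.

Let pow_neg (x : R) : (0 <= x -> Num.max (- x) 0 `^ r = 0) * (x < 0 -> Num.max x 0 `^ r = 0).
Proof.
by split=> x0; rewrite (max_idPr _) ?powR0 ?gt_eqF ?oppr_le0// ltW.
Qed.

(** Positive and negative parts remove the case distinction, so continuity at 0 reduces to that of
    the power of the positive part. *)
Lemma Re_powerE (x : R) :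
  Re_power r x = Num.max x 0 `^ r + Num.max (- x) 0 `^ r * cos (r * pi).
Proof.
rewrite /Re_power; have [x0|] := boolP (0 <= x); last rewrite -ltNge => x0.
  by rewrite (pow_neg x).1// (max_idPl x0) mul0r addr0.
by rewrite (pow_neg x).2// add0r ltr0_norm// (max_idPl _)// oppr_ge0 ltW.
Qed.

Lemma Im_powerE (x : R) : Im_power r x = Num.max (- x) 0 `^ r * sin (r * pi).
Proof.
rewrite /Im_power; have [x0|] := boolP (0 <= x); last rewrite -ltNge => x0.
  by rewrite (pow_neg x).1// mul0r.
by rewrite ltr0_norm// (max_idPl _)// oppr_ge0 ltW.
Qed.

Let continuous_pos_powRN : continuous (fun x : R => Num.max (- x) 0 `^ r).
Proof.
move=> x; apply: (@continuous_comp _ _ _ (fun x : R => - x) (fun y => Num.max y 0 `^ r)).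
  exact: opp_continuous.
exact: continuous_pos_powR.
Qed.

Lemma continuous_Re_power : continuous (Re_power r).
Proof.
rewrite (funext Re_powerE) => x; apply: cvgD; first exact: continuous_pos_powR.
by apply: cvgM; [exact: continuous_pos_powRN|exact: cvg_cst].
Qed.

Lemma continuous_Im_power : continuous (Im_power r).
Proof.
rewrite (funext Im_powerE) => x.
by apply: cvgM; [exact: continuous_pos_powRN|exact: cvg_cst].
Qed.

Let powR_norm_le1 (x : R) : `|x| <= 1 -> `|x| `^ r <= 1.
Proof.
move=> x1; rewrite -[leRHS](_ : 1 `^ r = 1); last by rewrite powR1.
by rewrite ge0_ler_powR// ?nnegrE// ltW.
Qed.

Lemma normr_Re_power_le1 (x : R) : `|x| <= 1 -> `|Re_power r x| <= 1.
Proof.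
move=> x1; rewrite /Re_power; case: ifPn => x0.
  by have := powR_norm_le1 x1; rewrite (ger0_norm x0) ger0_norm ?powR_ge0.
rewrite normrM (ger0_norm (powR_ge0 _ _)) -[leRHS]mulr1.
by rewrite ler_pM ?powR_ge0 ?powR_norm_le1// ler_norml cos_geN1 cos_le1.
Qed.

Lemma normr_Im_power_le1 (x : R) : `|x| <= 1 -> `|Im_power r x| <= 1.
Proof.
move=> x1; rewrite /Im_power; case: ifPn => x0; first by rewrite normr0.
rewrite normrM (ger0_norm (powR_ge0 _ _)) -[leRHS]mulr1.
by rewrite ler_pM ?powR_ge0 ?powR_norm_le1// ler_norml sin_geN1 sin_le1.
Qed.

End complex_power.

(** * Distribution functions as expectations of indicators of rays *)

Lemma expectation_indic_cdf d (T : measurableType d) (R : realType)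
    (P : probability T R) (Z : {RV P >-> R}) (x : R) :
  'E_P[(\1_(`]-oo, x]%classic) : R -> R) \o Z] = cdf Z x.
Proof.
have mZ : measurable (Z @^-1` `]-oo, x]).
  by rewrite -[Z @^-1` _]setTI; apply: (measurable_funPT Z) => //; exact: measurable_itv.
by rewrite unlock /cdf /distribution /pushforward -[Z @^-1` _]setIT -integral_indic.
Qed.

Lemma continuous_indic_ray (R : realType) (x c : R) : c != x ->
  {for c, continuous (\1_(`]-oo, x]%classic) : R -> R)}.
Proof.
move=> cx; apply: cvg_near_cst.
have [cltx|xltc|cE] := ltgtP c x; last by rewrite cE eqxx in cx.
- near=> y; rewrite !indicE !mem_set//= in_itv/=; first exact: ltW.
  by near: y; exact: (cvgr_le c cvg_id).
- near=> y; rewrite !indicE !memNset//= in_itv/=; apply/negP; rewrite -ltNge//.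
  by near: y; exact: (cvgr_gt c cvg_id).
Unshelve. all: by end_near. Qed.

(** At [a] the first term jumps by [p], and the second, being nondecreasing, cannot compensate. *)
Lemma two_jumps_continuity_point (R : realType) (p q a b x : R) : 0 < p -> 0 <= q ->
  {for x, continuous (fun y : R => (p * (a <= y)%R%:R + q * (b <= y)%R%:R)%:E)} -> a != x.
Proof.
move=> p0 q0 /fine_cvg /= /cvgrPdist_lt /(_ p p0) /nbhs_ballP[dl /= dl0 near_x].
apply/eqP => ax; rewrite {}ax in near_x.
(* A point to the left of [x], where the first indicator vanishes: the difference of values is at
   least the jump [p], which was taken as tolerance. *)
have y_near : ball x dl (x - dl / 2).
  rewrite /ball /= opprB addrC subrK ger0_norm; first by move: dl0; lra.
  by rewrite divr_ge0// ltW.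
have := near_x _ y_near => /=.
have -> : (x <= x - dl / 2) = false by apply/negbTE; rewrite -ltNge gtrBl divr_gt0.
rewrite lexx mulr0 add0r mulr1 ltNge => /negP; apply.
have bb : (b <= x - dl / 2)%R%:R <= (b <= x)%R%:R :> R.
  case: (leP b (x - dl / 2)) => // bx; rewrite (le_trans bx)//.
  by rewrite gerBl divr_ge0// ltW.
apply: le_trans (ler_norm _); have := ler_wpM2l q0 bb; lra.
Qed.

(** * Convergence in distribution and of the moments *)

Theorem theorem10p1 (R : realType) (d : measure_display)
    (Omega : measurableType d) (P : probability Omega R) (p : R)
    (X : nat -> {RV P >-> R}) (K : nat -> {RV P >-> nat}) (e : nat -> {RV P >-> R})
    (d' : measure_display) (Omega' : measurableType d') (P' : probability Omega' R)
    (S : {RV P' >-> R}) :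
  0 < p < 1 ->
  erw_first_and_last p X K e ->
  equals_pm p ((2 * p - 1) / (3 - 2 * p)) S ->
  [/\ cvg_in_distribution (fun n => walk_mean X n : {RV P >-> R}) S,
      {ae P, forall w, forall n : nat, (0 < n)%N -> `|walk_mean X n w| <= 1},
      forall r : nat, (0 < r)%N ->
        'E_P[fun w => walk_mean X n w ^+ r] @[n --> \oo] --> 'E_P'[fun w => S w ^+ r]
    & forall r : R, 0 < r ->
        'E_P[fun w => Re_power r (walk_mean X n w)] @[n --> \oo]
          --> 'E_P'[fun w => Re_power r (S w)] /\
        'E_P[fun w => Im_power r (walk_mean X n w)] @[n --> \oo]
          --> 'E_P'[fun w => Im_power r (S w)]].
Proof.
move=> p01 erwX lawS.
have cvgE (f : R -> R) := expectation_walk_mean_cvg p01 erwX lawS (f := f).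
split.
- move=> x cdfx; set c := limit_ratio p.
  have [p0 p1] := andP p01.
  have cdfE y : cdf S y = (p * (c <= y)%R%:R + (1 - p) * (- c <= y)%R%:R)%:E.
    rewrite /cdf lawS//.
    by rewrite !diracE !mem_setE !in_itv.
  (* Both masses [p] and [1 - p] are positive, so a continuity point of the limit differs from [c]
     and from [- c], and the indicator of the ray is continuous at both. *)
  have cx : c != x.
    apply: (@two_jumps_continuity_point _ p (1 - p) c (- c)); rewrite ?subr_ge0 ?ltW//.
    by rewrite -(funext cdfE).
  have ncx : - c != x.
    apply: (@two_jumps_continuity_point _ (1 - p) p (- c) c); rewrite ?subr_gt0// ?ltW//.
    rewrite (_ : (fun y => _) = cdf S)//.
    by apply/funext => y; rewrite cdfE addrC.
  rewrite -expectation_indic_cdf.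
  rewrite (_ : (fun n => _) =
      fun n => 'E_P[fun w => (\1_(`]-oo, x]%classic) : R -> R) (walk_mean X n w)]).
    apply: (cvgE _ 1) => //.
    - by move=> y _; rewrite indicE; case: (_ \in _); rewrite ?normr1 ?normr0.
    - exact: continuous_indic_ray.
    - exact: continuous_indic_ray.
  by apply/funext => n; rewrite -expectation_indic_cdf.
- exact: ae_normr_walk_mean_le1 erwX.
- move=> r _; apply: (cvgE (fun x => x ^+ r) 1).
  + exact: exprn_measurable.
  + by move=> x x1; rewrite normrX exprn_ile1.
  + exact: exprn_continuous.
  + exact: exprn_continuous.
- move=> r r0; split.
    apply: (cvgE (Re_power r) 1).
    - apply: continuous_measurable_fun; exact: continuous_Re_power.
    - exact: normr_Re_power_le1.
    - exact: continuous_Re_power.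
    - exact: continuous_Re_power.
  apply: (cvgE (Im_power r) 1).
  - apply: continuous_measurable_fun; exact: continuous_Im_power.
  - exact: normr_Im_power_le1.
  - exact: continuous_Im_power.
  - exact: continuous_Im_power.
Qed.
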